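(* Let $G$ be a graph of maximum degree $\Delta_1$ and let $H$ be a graph of order $n_2$. Then $$\Delta_1+n_2+1\le \chi_{\le 2}(G\odot H)\le \chi_{\le 2}(G)+n_2.$$
   Context: All graphs are finite, undirected, without loops or multiple edges. The order of a graph is its number of vertices. For graphs $G$ and $H$, where $G$ has vertices $v_1,\dots,v_{n_1}$, the corona graph $G\odot H$ is obtained from one copy of $G$ and $n_1$ copies of $H$ by joining by an edge each vertex of the $i$-th copy of $H$ with the vertex $v_i$ of $G$. A distance-$k$ coloring of a graph is an assignment of colors to its vertices such that any two different vertices at distance at most $k$ receive different colors; $\chi_{\le k}(G)$ denotes the minimum number of colors in a distance-$k$ coloring of $G$. *)

(* Defs.v *)
From mathcomp Require Import all_boot.
Set Implicit Arguments.
Unset Strict Implicit.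
Unset Printing Implicit Defensive.

Record sgraph := SGraph {
  vertex :> finType;
  edge : rel vertex;
  edge_sym : symmetric edge;
  edge_irrefl : irreflexive edge
}.

Definition degree (G : sgraph) (v : G) : nat := #|[set u | edge v u]|.

(* A maximum is attained, so this holds for no [D] when [G] has no vertex;
   [\max_(v : G) degree v] would instead be 0 there. *)
Definition max_degree (G : sgraph) (D : nat) : Prop :=
  (exists v : G, degree v = D) /\ (forall v : G, degree v <= D).

Definition has_walk (G : sgraph) (x y : G) : pred nat :=
  fun n => [exists p : n.-tuple G, path (@edge G) x p && (last x p == y)].

Lemma connect_has_walk (G : sgraph) (x y : G) :
  connect (@edge G) x y -> exists n, has_walk x y n.
Proof.
case/connectP=> p walk_p def_y; exists (size p).
by apply/existsP; exists (in_tuple p); rewrite /= walk_p def_y eqxx.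
Qed.

(* [None] is the infinite distance between distinct components. *)
Definition dist (G : sgraph) (x y : G) : option nat :=
  match @idP (connect (@edge G) x y) with
  | ReflectT xy => Some (ex_minn (connect_has_walk xy))
  | ReflectF _ => None
  end.

Definition dist_at_most (G : sgraph) (k : nat) (x y : G) : bool :=
  if dist x y is Some d then d <= k else false.

Lemma dist_at_mostP (G : sgraph) (k : nat) (x y : G) :
  reflect (exists p, [/\ path (@edge G) x p, last x p = y & size p <= k])
          (dist_at_most k x y).
Proof.
rewrite /dist_at_most /dist; case: {-}_ / idP => [xy | not_xy].
  apply: (iffP idP) => [|[p [walk_p last_p le_pk]]]; case: ex_minnP => d.
    case/existsP=> t /andP[walk_t /eqP last_t] _ le_dk.
    by exists t; rewrite size_tuple.
  move=> _ d_min; apply: leq_trans le_pk; apply: d_min; apply/existsP.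
  by exists (in_tuple p); rewrite /= walk_p last_p eqxx.
by right=> -[p [walk_p last_p _]]; case: not_xy; apply/connectP; exists p.
Qed.

Definition dist_coloring (G : sgraph) (k m : nat) (c : {ffun G -> 'I_m}) : bool :=
  [forall x, forall y, (x != y) && dist_at_most k x y ==> (c x != c y)].

Definition dist_colorable (G : sgraph) (k : nat) : pred nat :=
  fun m => [exists c : {ffun G -> 'I_m}, dist_coloring k c].

Lemma dist_colorable_order (G : sgraph) (k : nat) : exists m, dist_colorable G k m.
Proof.
exists #|G|; apply/existsP; exists [ffun x => enum_rank x].
apply/forallP=> x; apply/forallP=> y; apply/implyP=> /andP[neq_xy _].
by rewrite !ffunE (inj_eq enum_rank_inj).
Qed.

Definition dist_chi (k : nat) (G : sgraph) : nat :=
  ex_minn (dist_colorable_order G k).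

(* [inl v] is the vertex [v] of [G]; [inr (v, h)] is the vertex [h] of the
   copy of [H] attached to [v]. *)
Definition corona_edge (G H : sgraph) : rel (G + G * H) :=
  fun a b =>
    match a, b with
    | inl u, inl v => edge u v
    | inl u, inr (v, _) => u == v
    | inr (u, _), inl v => u == v
    | inr (u, h), inr (v, h') => (u == v) && edge h h'
    end.

Lemma corona_edge_sym (G H : sgraph) : symmetric (@corona_edge G H).
Proof.
by move=> [u | [u h]] [v | [v h']] //=; rewrite ?(eq_sym u) // edge_sym.
Qed.

Lemma corona_edge_irrefl (G H : sgraph) : irreflexive (@corona_edge G H).
Proof. by move=> [u | [u h]] /=; rewrite edge_irrefl // andbF. Qed.

Definition corona (G H : sgraph) : sgraph :=
  SGraph (@corona_edge_sym G H) (@corona_edge_irrefl G H).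

(* Main.v *)
(* A closed neighbourhood consists of vertices pairwise at distance at most 2,
   so it needs pairwise distinct colours; in the corona the closed neighbourhood
   of a vertex of [G] of maximum degree has [Delta1 + n2 + 1] elements.
   Conversely, colour [G] optimally and reuse the same [n2] fresh colours,
   bijectively, on every copy of [H]: distinct copies are at distance at least 3,
   and the distances between vertices of [G] are not shortened by the copies. *)
Require Import Defs.
From mathcomp Require Import all_boot.

Lemma dist_at_most_2P (G : sgraph) (x y : G) :
  x != y ->
  reflect (edge x y \/ exists2 z, edge x z & edge z y) (dist_at_most 2 x y).
Proof.
move=> neq_xy; apply: (iffP (dist_at_mostP 2 x y)).
  case=> -[|u [|w [|? ?]]] [] //=.
  - by move=> _ eq_xy; rewrite eq_xy eqxx in neq_xy.
  - by rewrite andbT => xu <-; left.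
  - by case/and3P=> xu uw _ <-; right; exists u.
case=> [xy | [z xz zy]]; first by exists [:: y]; rewrite /= xy.
by exists [:: z; y]; rewrite /= xz zy.
Qed.

Lemma dist_coloringP (G : sgraph) (k m : nat) (c : {ffun G -> 'I_m}) :
  reflect (forall x y, x != y -> dist_at_most k x y -> c x != c y)
          (dist_coloring k c).
Proof.
apply: (iffP forallP) => c_ok x; last first.
  by apply/forallP=> y; apply/implyP=> /andP[]; apply: c_ok.
by move=> y neq_xy d_xy; move/forallP/(_ y): (c_ok x); rewrite neq_xy d_xy.
Qed.

Lemma dist_chi_coloring (k : nat) (G : sgraph) :
  exists c : {ffun G -> 'I_(dist_chi k G)}, dist_coloring k c.
Proof. by rewrite /dist_chi; case: ex_minnP => m /existsP. Qed.

Lemma dist_chi_min (G : sgraph) (k m : nat) (c : {ffun G -> 'I_m}) :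
  dist_coloring k c -> dist_chi k G <= m.
Proof.
move=> c_ok; rewrite /dist_chi; case: ex_minnP => d _; apply.
by apply/existsP; exists c.
Qed.

Lemma degree_lt_dist_chi2 (G : sgraph) (v : G) : degree v < dist_chi 2 G.
Proof.
have [c /dist_coloringP c_ok] := dist_chi_coloring 2 G.
pose N := v |: [set u | edge v u].
have c_inj : {in N &, injective c}.
  move=> x y; rewrite !inE => Nx Ny /eqP; apply: contraTeq => neq_xy.
  apply: c_ok => //; apply/dist_at_most_2P => //.
  (* Two distinct neighbours of [v] are joined through [v] itself; a pair containing [v] is an
     edge. *)
  case/predU1P: Nx neq_xy => [-> | vx]; case/predU1P: Ny => [-> | vy] neq_xy.
  - by rewrite eqxx in neq_xy.
  - by left.
  - by left; rewrite edge_sym.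
  - by right; exists v; rewrite // edge_sym.
have <- : #|N| = (degree v).+1 by rewrite cardsU1 inE edge_irrefl.
by rewrite -(card_in_imset c_inj) -[leqRHS]card_ord max_card.
Qed.

(** The neighbourhood of [inl v] is the disjoint union of the old neighbourhood of [v] and the whole
    copy of [H] at [v]. *)
Lemma degree_corona (G H : sgraph) (v : G) :
  degree (inl v : corona G H) = degree v + #|H|.
Proof.
rewrite /degree -(card_imset [set u | edge v u] (@inl_inj _ (G * H))).
have inr_v_inj : injective (fun h : H => inr (v, h) : G + G * H).
  by move=> h h' [].
rewrite -(card_imset H inr_v_inj) -cardsUI.
set A := [set inl _ | _ in _]; set B := [set inr _ | _ in _].
have -> : A :&: B = set0.
  apply/setP=> a; rewrite !inE; apply/negP=> /andP[/imsetP[u _ ->]].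
  by case/imsetP.
rewrite cards0 addn0; apply: eq_card => -[u | [u h]]; rewrite !inE /=.
  rewrite mem_imset ?inE; last exact: inl_inj.
  by case: imsetP => [[] // | _]; rewrite orbF.
have -> : (inr (u, h) \in A) = false by apply/imsetP=> -[].
by apply/eqP/imsetP=> [-> | [h' _ [-> _]] //]; exists h.
Qed.

Lemma dist_chi2_corona_le (G H : sgraph) :
  dist_chi 2 (corona G H) <= dist_chi 2 G + #|H|.
Proof.
have [c /dist_coloringP c_ok] := dist_chi_coloring 2 G.
pose f (a : corona G H) : 'I_(dist_chi 2 G + #|H|) :=
  match a with
  | inl v => lshift _ (c v)
  | inr (_, h) => rshift _ (enum_rank h)
  end.
apply: (@dist_chi_min _ 2 _ [ffun a => f a]); apply/dist_coloringP=> a b neq_ab.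
move/(dist_at_most_2P _ _ _ neq_ab); rewrite !ffunE.
(* Mixed pairs get colours from disjoint ranges, so only pairs within [G] and pairs of copy vertices
   remain. *)
case: a b neq_ab => [u | [u h]] [v | [v h']] neq_ab d_ab /=;
  rewrite ?eq_lrshift ?eq_rlshift //.
- have neq_uv : u != v by apply: contraNneq neq_ab => ->.
  rewrite eq_lshift c_ok //; apply/dist_at_most_2P => //.
  case: d_ab => [uv | [[w | [w h]] /= uw wv]]; [by left | by right; exists w |].
  (* A middle vertex in a copy has a single neighbour in [G], which would force [u = v]. *)
  by rewrite (eqP uw) (eqP wv) eqxx in neq_uv.
(* An edge between copy vertices stays in one copy, and a middle vertex, in [G] or in a copy, meets
   only one copy. *)
- have eq_uv : u = v.
    case: d_ab => [/andP[/eqP] // | [[w | [w k]] /=]].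
      by move=> /eqP -> /eqP.
    by case/andP=> /eqP -> _ /andP[/eqP].
  rewrite eq_rshift (inj_eq enum_rank_inj).
  by apply: contraNneq neq_ab => ->; rewrite eq_uv.
Qed.

Theorem theorem3 (G H : sgraph) (Delta1 n2 : nat) :
  max_degree G Delta1 ->
  #|H| = n2 ->
  Delta1 + n2 + 1 <= dist_chi 2 (corona G H)
  /\ dist_chi 2 (corona G H) <= dist_chi 2 G + n2.
Proof.
case=> [[v <-] _] <-; split; last exact: dist_chi2_corona_le.
(* The summand 1 counts [inl v] itself, through the strict inequality. *)
by rewrite addn1 -degree_corona degree_lt_dist_chi2.
Qed.
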